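(* There is no exotic coBUG with a connected component isomorphic to $K_{1,5}$.
   Context: All graphs are finite, simple, undirected, with nonempty vertex set. For distinct vertices $v,w$ of a connected graph $G$, let $\sigma_{vw}$ be the number of shortest paths between $v$ and $w$, and $\sigma_{vw}(x)$ the number of those containing $x$ as an internal vertex (so $\sigma_{vw}(x)=0$ if $x\in\{v,w\}$). The betweenness of a vertex $x$ is $B_G(x)=\sum_{\{v,w\}\subseteq V(G)}\frac{\sigma_{vw}(x)}{\sigma_{vw}}$, the sum being over unordered pairs of distinct vertices. A betweenness-uniform graph (BUG) is a connected graph $G$ in which all vertices have the same betweenness; this common value is the betweenness of $G$. A low-betweenness BUG is a BUG with betweenness smaller than $1$. Stars are the graphs $K_{1,\ell}$ with $\ell\ge 0$ ($K_{1,0}$ is the single-vertex graph). An exotic BUG is a low-betweenness BUG whose complement is not a disjoint union of stars of the same size (i.e. there is no $\ell\ge0$ such that every connected component of the complement is isomorphic to $K_{1,\ell}$). An exotic coBUG is the complement of an exotic BUG. *)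

(* Defs.v *)
From mathcomp Require Import all_boot all_order all_algebra.

Set Implicit Arguments.
Unset Strict Implicit.
Unset Printing Implicit Defensive.

Import Order.TTheory GRing.Theory Num.Theory.
Local Open Scope ring_scope.

(* The vertex set may be empty here; the nonemptiness convention is imposed
   in [connected_graph]. *)
Record sgraph := SGraph {
  vertex :> finType;
  adj : rel vertex;
  adj_sym : symmetric adj;
  adj_irrefl : irreflexive adj }.

Definition isomorphic (G H : sgraph) : Prop :=
  exists2 f : G -> H, bijective f & {mono f : x y / adj x y}.

Section Constructions.
Variable G : sgraph.

Definition compl_adj : rel G := fun x y => (x != y) && ~~ adj x y.

Fact compl_adj_sym : symmetric compl_adj.
Proof. by move=> x y; rewrite /compl_adj eq_sym adj_sym. Qed.

Fact compl_adj_irrefl : irreflexive compl_adj.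
Proof. by move=> x; rewrite /compl_adj eqxx. Qed.

Definition complement : sgraph := SGraph compl_adj_sym compl_adj_irrefl.

Variable S : {set G}.

Definition induced_adj : rel {x : G | x \in S} :=
  fun x y => adj (val x) (val y).

Fact induced_adj_sym : symmetric induced_adj.
Proof. by move=> x y; apply: adj_sym. Qed.

Fact induced_adj_irrefl : irreflexive induced_adj.
Proof. by move=> x; apply: adj_irrefl. Qed.

Definition induced : sgraph := SGraph induced_adj_sym induced_adj_irrefl.
End Constructions.

Definition component (G : sgraph) (x : G) : sgraph :=
  induced [set y | connect (@adj G) x y].

Definition connected_graph (G : sgraph) : Prop :=
  (0 < #|G|)%N /\ forall x y : G, connect (@adj G) x y.

Section Star.
Variable l : nat.

(* [None] is the centre and the [Some i] are the leaves. *)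
Definition star_adj : rel (option 'I_l) :=
  fun x y => (x == None) (+) (y == None).

Fact star_adj_sym : symmetric star_adj.
Proof. by move=> x y; rewrite /star_adj addbC. Qed.

Fact star_adj_irrefl : irreflexive star_adj.
Proof. by move=> x; rewrite /star_adj addbb. Qed.

Definition star : sgraph := SGraph star_adj_sym star_adj_irrefl.
End Star.

Section Betweenness.
Variable G : sgraph.
Implicit Types v w x : G.

(* [p] lists the vertices of the path after its starting point [v], so that
   [size p] is its number of edges. *)
Definition path_between v w (p : seq G) : bool :=
  [&& path (@adj G) v p, uniq (v :: p) & last v p == w].

(* The value is the junk [#|G|] when no path joins [v] to [w]. *)
Definition dist v w : nat :=
  find (fun n => [exists p : n.-tuple G, path_between v w p]) (iota 0 #|G|).

Definition shortest_paths v w : {set (dist v w).-tuple G} :=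
  [set p : (dist v w).-tuple G | path_between v w p].

Definition sigma v w : nat := #|shortest_paths v w|.

Definition sigma_through v w x : nat :=
  #|[set p in shortest_paths v w | [&& x \in v :: p, x != v & x != w]]|.

(* Comparing ranks selects each unordered pair of distinct vertices exactly
   once; as [G] is undirected, the summand does not depend on the orientation
   selected. *)
Definition betweenness x : rat :=
  \sum_(v : G) \sum_(w : G | (enum_rank v < enum_rank w)%N)
    (sigma_through v w x)%:R / (sigma v w)%:R.
End Betweenness.

Definition BUG (G : sgraph) : Prop :=
  connected_graph G /\ forall x y : G, betweenness x = betweenness y.

Definition low_betweenness_BUG (G : sgraph) : Prop :=
  BUG G /\ forall x : G, betweenness x < 1.

Definition union_of_equal_stars (G : sgraph) : Prop :=
  exists l : nat, forall x : G, isomorphic (component x) (star l).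

Definition exotic_BUG (G : sgraph) : Prop :=
  low_betweenness_BUG G /\ ~ union_of_equal_stars (complement G).

(* Graphs are considered up to isomorphism. *)
Definition exotic_coBUG (H : sgraph) : Prop :=
  exists2 G : sgraph, exotic_BUG G & isomorphic H (complement G).

(* Main.v *)
Require Import Defs.
From mathcomp Require Import all_boot all_order all_algebra.
From mathcomp Require Import ring lra zify.

(* Let G be a low-betweenness BUG on n vertices whose complement H has a component
   K_{1,5}, and suppose that H has another component. Then G has diameter 2, only
   the edges vw of H contribute to the betweenness, and vw contributes
   1 / (n - |N(v) u N(w)|) to each vertex outside N(v) u N(w), where N is the
   neighbourhood in H. Uniformity thus says that the load of x, the total
   contribution of the edges vw with x in N(v) u N(w), does not depend on x, and
   the K_{1,5} shows that it is 5 / (n - 6). Summing the betweenness over all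
   vertices shows that H has fewer than n edges.
   Comparing a leaf of H with its neighbour shows that the leaves of H lie in
   components K_{1,5}. Let R be the set of the vertices in other components; they
   have degree at least 2. As each K_{1,5} has one edge less than vertices, the
   edge count bounds the sum of deg x - 2 over R by twice the number of the
   K_{1,5}, which makes n at least 17 as soon as that sum is at least 2. A vertex
   of R of degree at least 4 then has load more than 5 / (n - 6). If all degrees
   are at most 3, then a vertex of R of degree 2 has load less than 5 / (n - 6),
   unless its neighbours are nonadjacent of degree 3, when the load is more than
   that; and if all degrees are 3, the load is more than 5 / (n - 6) again. So R is
   empty and H is a disjoint union of stars K_{1,5}. *)

Set Implicit Arguments.
Unset Strict Implicit.
Unset Printing Implicit Defensive.

Import Order.TTheory GRing.Theory Num.Theory.
Local Open Scope ring_scope.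

(** * Neighbourhoods, weights and loads *)

Section Neighbourhoods.
Variable H : sgraph.
Implicit Types v w x y z : H.

Definition nbr x : {set H} := [set y | adj x y].
Definition deg x : nat := #|nbr x|.
Definition edge_nbr v w : {set H} := nbr v :|: nbr w.
(* For an edge [vw] this is the inverse of the number of common neighbours of [v]
   and [w] in the complement; it is [0] if there are none. *)
Definition weight v w : rat := (#|H| - #|edge_nbr v w|)%:R^-1.
Definition star_centre x : bool := (deg x == 5) && [forall y in nbr x, deg y == 1].

(* Each edge is counted twice, as the sum runs over ordered pairs. *)
Definition load x : rat :=
  \sum_(v : H) \sum_(w in nbr v | x \in edge_nbr v w) weight v w.

Lemma in_nbr x y : (y \in nbr x) = adj x y.
Proof. by rewrite inE. Qed.

Lemma nbr_sym x y : (y \in nbr x) = (x \in nbr y).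
Proof. by rewrite !inE adj_sym. Qed.

Lemma nbr_irrefl x : (x \in nbr x) = false.
Proof. by rewrite inE adj_irrefl. Qed.

Lemma weightC v w : weight v w = weight w v.
Proof. by rewrite /weight /edge_nbr setUC. Qed.

Lemma weight_ge0 v w : 0 <= weight v w.
Proof. by rewrite invr_ge0 ler0n. Qed.

(** The vertex [v] itself lies in [nbr w], outside [nbr v]. *)
Lemma card_edge_nbr_ge v w : w \in nbr v -> ((deg v).+1 <= #|edge_nbr v w|)%N.
Proof.
move=> vw; rewrite /deg -add1n -[1%N](cards1 v).
have dv: [disjoint [set v] & nbr v] by rewrite disjoints1 nbr_irrefl.
rewrite -cardsUI (_ : _ :&: _ = set0) ?cards0 ?addn0; last first.
  by apply/eqP; rewrite setI_eq0.
by apply: subset_leq_card; rewrite subUset sub1set /edge_nbr inE -(nbr_sym v) vw orbT subsetUl.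
Qed.

Lemma card_edge_nbr_le v w : (#|edge_nbr v w| <= deg v + deg w)%N.
Proof. by rewrite /deg -cardsUI leq_addr. Qed.

Lemma weight_ge_deg v w k : (#|edge_nbr v w| < #|H|)%N -> w \in nbr v -> (k <= deg v)%N ->
  (#|H|%:R - k.+1%:R)^-1 <= weight v w.
Proof.
move=> lt vw kd; have ge := card_edge_nbr_ge vw.
rewrite /weight -natrB; last by lia.
by rewrite lef_pV2 ?posrE ?ltr0n ?ler_nat; lia.
Qed.

Lemma weight_le_deg v w k : (deg v + deg w <= k < #|H|)%N ->
  weight v w <= (#|H|%:R - k%:R)^-1.
Proof.
move=> /andP[dk kH]; have le := card_edge_nbr_le v w.
rewrite /weight -natrB; last by lia.
by rewrite lef_pV2 ?posrE ?ltr0n ?ler_nat; lia.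
Qed.

Lemma weight_leaf v w : w \in nbr v -> deg w = 1%N ->
  weight v w = (#|H| - (deg v).+1)%:R^-1.
Proof.
move=> vw dw; have ge := card_edge_nbr_ge vw; have le := card_edge_nbr_le v w.
by rewrite /weight; congr (_ - _)%:R^-1; lia.
Qed.

(** Groups the edges by an endpoint [y] in [nbr x]. An edge with both ends in [nbr x] turns up from
    either end, so each occurrence gets multiplicity 1 instead of 2. *)
Lemma loadE x : load x =
  \sum_(y in nbr x) (weight y x *+ 2 + \sum_(z in nbr y :\ x) (weight y z *+ 2 - (z \in nbr x)%:R * weight y z)).
Proof.
pose f v w : rat := (w \in nbr v)%:R * weight v w.
have fC v w : f v w = f w v by rewrite /f nbr_sym weightC.
(* Inclusion-exclusion: an ordered pair counts if its first or its second entry is in [nbr x]. *)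
have -> : load x = (\sum_v \sum_w (v \in nbr x)%:R * f v w) * 2
   - \sum_v \sum_w (v \in nbr x)%:R * (w \in nbr x)%:R * f v w.
  rewrite mulr_natr mulr2n [in X in _ + X - _]exchange_big -big_split -sumrB /=; apply: eq_bigr => v _.
  rewrite -big_split -sumrB big_mkcond; apply: eq_bigr => w _ /=.
  rewrite in_setU -(nbr_sym x v) -(nbr_sym x w) (fC w v) /f.
  case: (w \in nbr v); case: (v \in nbr x); case: (w \in nbr x) => /=; lra.
rewrite mulr_suml -sumrB [RHS]big_mkcond; apply: eq_bigr => v _ /=.
case: ifP => vx; last first.
  rewrite big1 1?big1 ?mul0r ?subrr // => w _; by rewrite !mul0r.
rewrite (bigD1 x) //= (bigD1 x (F := fun w => _ * _ * _)) //= nbr_irrefl.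
rewrite mulr0 mul0r add0r mul1r {1}/f -nbr_sym vx mul1r mulrDl mulr_natr -addrA.
congr (_ + _); rewrite mulr_suml -sumrB [RHS]big_mkcond [LHS]big_mkcond /=.
apply: eq_bigr => w _; rewrite !inE !mul1r /f in_nbr.
by case: (w == x); case: (adj v w) => //=; rewrite ?mul1r ?mul0r ?mulr0 ?subrr ?mulr_natr.
Qed.

Lemma load_ge x : \sum_(y in nbr x) (weight y x *+ 2 + \sum_(z in nbr y :\ x) weight y z) <= load x.
Proof.
rewrite loadE; apply: ler_sum => y _; rewrite lerD2l; apply: ler_sum => z _.
by have := weight_ge0 y z; case: (z \in nbr x) => /=; lra.
Qed.

Lemma nbr_leaf x y : deg x = 1%N -> y \in nbr x -> nbr x = [set y].
Proof.
by move=> /eqP /cards1P[z ->]; rewrite inE => /eqP ->.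
Qed.

Lemma load_leaf x y : deg x = 1%N -> y \in nbr x ->
  load x = \sum_(z in nbr y) weight y z *+ 2.
Proof.
move=> dx xy; have yx: x \in nbr y by rewrite -nbr_sym.
rewrite loadE (nbr_leaf dx xy) big_set1 (bigD1 x yx) /=; congr (_ + _).
apply: eq_big => [z|z]; first by rewrite in_setD1 andbC.
rewrite in_setD1 inE => /andP[_ yz]; case: eqP => [zy|_]; last by rewrite mul0r subr0.
by rewrite zy nbr_irrefl in yz.
Qed.

(** * Leaves and the value of the common load *)

Section EqualLoads.
Hypothesis edge_nbr_lt : forall v w, w \in nbr v -> (#|edge_nbr v w| < #|H|)%N.
Hypothesis load_const : forall x y, load x = load y.
Hypothesis few_edges : (\sum_x deg x < 2 * #|H|)%N.
Variable c : H.
Hypothesis centre_c : star_centre c.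

Lemma weight_gt0 v w : w \in nbr v -> 0 < weight v w.
Proof. by move=> vw; rewrite invr_gt0 ltr0n subn_gt0 edge_nbr_lt. Qed.

Lemma load_leafE x y : deg x = 1%N -> y \in nbr x ->
  (forall z, z \in nbr y -> deg z = 1%N) ->
  load x = (deg y)%:R * 2 * (#|H|%:R - (deg y).+1%:R)^-1 /\ ((deg y).+1 < #|H|)%N.
Proof.
move=> dx xy leaves; have yx: x \in nbr y by rewrite -nbr_sym.
have lt: ((deg y).+1 < #|H|)%N.
  by apply: leq_ltn_trans (edge_nbr_lt yx); apply: card_edge_nbr_ge.
split=> //; rewrite (load_leaf dx xy) (eq_bigr (fun=> 2 * (#|H|%:R - (deg y).+1%:R)^-1)).
  by rewrite sumr_const -/(deg y) -mulrA [RHS]mulr_natl.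
move=> z yz; rewrite weight_leaf //; last exact: leaves.
by rewrite natrB 1?ltnW // mulr_natl.
Qed.

(** Evaluation at a leaf of the given [K_{1,5}]; the numerator is 10 and not 5 because [load] runs
    over ordered pairs. *)
Lemma loadP x : load x = 10 / (#|H|%:R - 6) /\ (6 < #|H|)%N.
Proof.
have /andP[/eqP dc /forall_inP leaves] := centre_c.
have /card_gt0P[y cy] : (0 < #|nbr c|)%N by rewrite -/(deg c) dc.
have yc : c \in nbr y by rewrite -nbr_sym.
have dy : deg y = 1%N by apply/eqP/leaves.
have [|e lt] := load_leafE dy yc; first by move=> z /leaves/eqP.
move: e lt; rewrite dc (load_const x y) => -> lt; split=> //; congr (_ / _); lra.
Qed.

Lemma order_gt6 : (6 < #|H|)%N. Proof. by case: (loadP c). Qed.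

Lemma deg_gt0 x : (0 < deg x)%N.
Proof.
rewrite lt0n cards_eq0; apply/eqP => x0.
have [e lt] := loadP x; move: e; rewrite loadE x0 big_set0 => /eqP.
rewrite eq_sym mulf_eq0 invr_eq0 subr_eq0 (eqr_nat _ _ 6) (gtn_eqF lt).
by rewrite (eqr_nat _ 10 0).
Qed.

(* Every edge at distance at most one from [x] is at distance at most one from [y];
   equality of the loads of [x] and [y] forbids any further edge near [y]. *)
Lemma leaf_nbr_centre x y : deg x = 1%N -> y \in nbr x -> star_centre y.
Proof.
move=> dx xy; have leaves z : z \in nbr y -> deg z = 1%N.
  move=> yz; have zy: y \in nbr z by rewrite -nbr_sym.
  have := load_ge y; rewrite (load_const y x) (load_leaf dx xy) big_split /=.
  rewrite [leRHS](eq_bigr (fun z => weight z y *+ 2)) => [|? _]; last by rewrite weightC.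
  rewrite gerDl => le0.
  have ge0 i : i \in nbr y -> 0 <= \sum_(u in nbr i :\ y) weight i u.
    by move=> _; apply: sumr_ge0 => u _; apply: weight_ge0.
  have /psumr_eq0P : \sum_(i in nbr y) \sum_(u in nbr i :\ y) weight i u = 0.
    by apply/le_anti; rewrite le0 sumr_ge0.
  move=> /(_ ge0 z yz) /psumr_eq0P e0; apply/eqP/cards1P; exists y.
  apply/setP=> u; rewrite in_set1; apply/idP/eqP => [zu|->//].
  apply/eqP/negP => /negP uy; have := weight_gt0 zu.
  by rewrite e0 ?ltxx ?in_setD1 ?uy // => i _; apply: weight_ge0.
rewrite /star_centre; apply/andP; split; last first.
  by apply/forall_inP => z /leaves ->.
have [e lt] := load_leafE dx xy leaves; have [e' gt] := loadP x.
(* With [d = deg y] and [n = #|H|], cross-multiplying [2d / (n - d - 1) = 10 / (n - 6)] gives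
   [(d - 5)(n - 1) = 0]. *)
move: e; rewrite e' => /eqP; rewrite -!natrB; [|lia..].
rewrite eqr_div ?pnatr_eq0 ?subn_eq0 -?ltnNge // -!natrM eqr_nat => /eqP; nia.
Qed.

(* The vertices outside the components isomorphic to K_{1,5}. *)
Definition rest : {set H} := [set x | ~~ star_centre x & deg x != 1%N].

(** Neighbours of centres are leaves and neighbours of leaves are centres, so [rest] is a union of
    components. *)
Lemma rest_nbr x y : x \in rest -> y \in nbr x -> y \in rest.
Proof.
rewrite !inE => /andP[xc x1] xy; apply/andP; split; apply/negP.
  by case/andP=> _ /forall_inP/(_ x); rewrite -nbr_sym (negbTE x1) in_nbr => /(_ xy).
move=> /eqP y1; case/negP: xc; apply: (leaf_nbr_centre y1).
by rewrite -nbr_sym in_nbr.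
Qed.

Lemma rest_deg x : x \in rest -> (1 < deg x)%N.
Proof. by rewrite inE => /andP[_]; have := deg_gt0 x; lia. Qed.

(** Double counting of centre-leaf edges: the unique neighbour of a leaf is a centre. *)
Lemma card_leaves : #|[set x | deg x == 1%N]| = (5 * #|[set x | star_centre x]|)%N.
Proof.
transitivity (\sum_(x | star_centre x) deg x)%N; last first.
  rewrite (eq_bigr (fun=> 5%N)) => [|x /andP[/eqP//]].
  by rewrite sum_nat_cond_const mulnC.
rewrite -sum1_card (eq_bigl (fun x => deg x == 1%N)) => [|x]; last by rewrite inE.
under [RHS]eq_bigr => x _ do rewrite /deg -sum1_card.
rewrite (exchange_big_dep (fun z => deg z == 1%N)) /=; last first.
  by move=> x z /andP[_ /forall_inP]; apply.
apply: eq_bigr => x /eqP x1.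
have /cards1P[y xy] : #|nbr x| == 1%N by apply/eqP.
have yx : y \in nbr x by rewrite xy set11.
rewrite (big_pred1 y) // => z; rewrite nbr_sym xy inE /=.
by case: eqP => [->|]; rewrite ?andbF // (leaf_nbr_centre x1 yx).
Qed.

(** The [6k] vertices outside [rest] have degree sum [10k], which leaves a slack of [2k] for
    [rest]. *)
Lemma rest_count : let k := #|[set x | star_centre x]| in
  (#|H| = 6 * k + #|rest| /\ \sum_(x in rest) deg x < 2 * k + 2 * #|rest|)%N.
Proof.
move=> k; have L := card_leaves.
have trich (F : H -> nat) : (\sum_x F x = \sum_(x in [set x | deg x == 1%N]) F x +
    \sum_(x in [set x | star_centre x]) F x + \sum_(x in rest) F x)%N.
  rewrite [X in (X + _ + _)%N]big_mkcond [X in (_ + X + _)%N]big_mkcond.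
  rewrite [X in (_ + X)%N]big_mkcond -!big_split; apply: eq_bigr => x _ /=.
  rewrite !inE /star_centre; case: eqP => [->|] //=; rewrite ?andbF ?addn0 //.
  by case: (_ && _) => //=; rewrite addn0.
have n : #|H| = (6 * k + #|rest|)%N.
  transitivity #|xpredT : pred H|; first exact: eq_card.
  by have := trich (fun=> 1%N); rewrite !sum1_card L => ->; rewrite /k; lia.
split=> //; move: few_edges; rewrite trich (eq_bigr (fun=> 1%N)); last first.
  by move=> x; rewrite inE => /eqP.
rewrite sum1_card L [X in (_ + X + _)%N](eq_bigr (fun=> 5%N)); last first.
  by move=> x; rewrite inE => /andP[/eqP].
by rewrite sum_nat_const n -/k; lia.
Qed.

(** * Excluding all degrees outside the components [K_{1,5}] *)

Lemma edge_nbr_rest x y : x \in rest -> y \in nbr x -> edge_nbr x y \subset rest.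
Proof.
move=> xR xy; have yR := rest_nbr xR xy.
by rewrite subUset; apply/andP; split; apply/subsetP => z; apply: rest_nbr.
Qed.

(** An excess of 2 forces two centres, hence 12 vertices outside [rest]; at least 5 more lie in
    [edge_nbr x y]. *)
Lemma order_ge17 x y (m := #|edge_nbr x y|) : x \in rest -> y \in nbr x ->
  (4 < m -> 2 * #|rest| + 2 <= \sum_(z in rest) deg z -> 17 <= #|H|)%N.
Proof.
move=> xR xy m4 excess; have [n few] := rest_count.
by have := subset_leq_card (edge_nbr_rest xR xy); rewrite -/m; lia.
Qed.

Lemma sum_rest_deg_ge (A : {set H}) : A \subset rest ->
  (2 * #|rest| + \sum_(x in A) (deg x - 2) <= \sum_(x in rest) deg x)%N.
Proof.
move=> AR; rewrite mulnC -sum_nat_const.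
have -> : (\sum_(x in A) (deg x - 2) = \sum_(x in rest) (if x \in A then deg x - 2 else 0))%N.
  rewrite -big_mkcondr; apply: eq_bigl => x /=.
  by case xA: (x \in A); rewrite ?andbF // (subsetP AR _ xA).
rewrite -big_split; apply: leq_sum => x xR /=; have := rest_deg xR.
by case: (x \in A); lia.
Qed.

(** Each neighbour [y] contributes the edge [xy] twice and at least [d] further edges, each at least
    once. *)
Lemma load_ge_deg x d (a b : rat) : 0 <= b ->
  (forall y, y \in nbr x -> (d < deg y)%N /\ a <= weight y x) ->
  (forall y z, y \in nbr x -> z \in nbr y -> b <= weight y z) ->
  (deg x)%:R * (a * 2 + d%:R * b) <= load x.
Proof.
move=> b0 ha hb; apply: le_trans (load_ge x); rewrite mulr_natl -sumr_const.
apply: ler_sum => y xy; have [dy ay] := ha _ xy.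
rewrite mulr_natr lerD ?lerMn2r ?ay ?orbT //.
apply: (@le_trans _ _ (\sum_(z in nbr y :\ x) b)).
  rewrite sumr_const -[b *+ _]mulr_natl ler_wpM2r ?ler_nat //.
  by move: dy; rewrite /deg (cardsD1 x) -nbr_sym xy.
by apply: ler_sum => z; rewrite in_setD1 => /andP[_]; apply: hb.
Qed.

Lemma weight_bound v w k : w \in nbr v -> (k <= deg v)%N -> (#|H|%:R - k.+1%:R)^-1 <= weight v w.
Proof. by move=> vw; apply: weight_ge_deg => //; apply: edge_nbr_lt. Qed.

Lemma rest_deg_le3 x : x \in rest -> (deg x <= 3)%N.
Proof.
move=> xR; rewrite leqNgt; apply/negP => x4.
have /card_gt0P[y xy] := deg_gt0 x.
have n17 : (17 <= #|H|)%N.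
  apply: (order_ge17 xR xy); first by have := card_edge_nbr_ge xy; lia.
  have := @sum_rest_deg_ge [set x]; rewrite sub1set big_set1 => /(_ xR); lia.
pose N : rat := #|H|%:R; have N17 : 17 <= N by rewrite (ler_nat _ 17).
(* Edges at [x] have at least 5 vertices in their [edge_nbr]; further edges have at least 3, as
   degrees in [rest] are at least 2. *)
have : (deg x)%:R * ((N - 5)^-1 * 2 + 1%:R * (N - 3)^-1) <= load x.
  apply: load_ge_deg; first by rewrite invr_ge0; lra.
    move=> z xz; split; first exact: rest_deg (rest_nbr xR xz).
    by rewrite weightC; apply: weight_bound.
  by move=> z u xz zu; apply: weight_bound => //; apply: rest_deg (rest_nbr xR xz).
rewrite (loadP x).1 -/N; apply/negP; rewrite -ltNge.
apply: (@lt_le_trans _ _ (4 * ((N - 5)^-1 * 2 + 1%:R * (N - 3)^-1))); last first.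
  rewrite ler_wpM2r ?(ler_nat _ 4) // addr_ge0 ?mulr_ge0 ?invr_ge0 //; lra.
rewrite -subr_gt0.
(* The numerator increases for [N >= 9] and equals 80 at [N = 17]. *)
have -> : 4 * ((N - 5)^-1 * 2 + 1%:R * (N - 3)^-1) - 10 / (N - 6) =
  (2 * N ^+ 2 - 36 * N + 114) / ((N - 5) * (N - 3) * (N - 6)).
  by field; rewrite !lt0r_neq0 //; lra.
by rewrite divr_gt0 // ?mulr_gt0; try lra; nra.
Qed.

(** For [n > 6], [10 / (n - 6) < 12 / (n - 4)] amounts to [n > 16], which is where the bound 17
    comes from. *)
Lemma load_lt x : (17 <= #|H|)%N -> load x < 12 / (#|H|%:R - 4).
Proof.
move=> n17; rewrite (loadP x).1.
have N17 : (17 : rat) <= #|H|%:R by rewrite (ler_nat _ 17).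
rewrite ltr_pdivrMr; last by lra.
rewrite mulrAC ltr_pdivlMr; lra.
Qed.

(* An edge [yz] with [z] in [nbr x] has multiplicity 1 instead of 2, because it is
   counted again in [far_count x z]. *)
Definition far_count x y : nat := (\sum_(z in nbr y :\ x) (2 - (z \in nbr x)))%N.

(** For [deg y <= 3] the count is thus at most 4, with equality only if [deg y = 3] and [x], [y]
    have no common neighbour. *)
Lemma far_countE x y : y \in nbr x ->
  (far_count x y + #|nbr x :&: nbr y| = 2 * (deg y).-1)%N.
Proof.
move=> xy; have -> : (deg y).-1 = #|nbr y :\ x|.
  by rewrite /deg (cardsD1 x) -nbr_sym xy.
have -> : #|nbr x :&: nbr y| = (\sum_(z in nbr y :\ x) (z \in nbr x))%N.
  rewrite -sum1_card big_mkcond [RHS]big_mkcond; apply: eq_bigr => z _ /=.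
  rewrite in_setI in_setD1; case: (z =P x) => [->|_]; first by rewrite nbr_irrefl.
  by case: (z \in nbr x); case: (z \in nbr y).
rewrite /far_count -big_split mulnC -sum_nat_const; apply: eq_bigr => z _ /=.
by case: (z \in nbr x).
Qed.

(** Degrees in [rest] are at most 3 and [deg x = 2], so [edge_nbr] has at most 5 vertices for edges
    at [x] and at most 6 for the others. *)
Lemma load_le_far_count x y1 y2 : x \in rest -> nbr x = [set y1; y2] -> y1 != y2 ->
  load x <= 4 / (#|H|%:R - 5) + (far_count x y1 + far_count x y2)%:R / (#|H|%:R - 6).
Proof.
move=> xR nx y12; have n6 := order_gt6.
have x2 : deg x = 2%N by rewrite /deg nx cards2 y12.
have bound y : y \in nbr x -> weight y x *+ 2 +
    \sum_(z in nbr y :\ x) (weight y z *+ 2 - (z \in nbr x)%:R * weight y z)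
    <= 2 / (#|H|%:R - 5) + (far_count x y)%:R / (#|H|%:R - 6).
  move=> xy; have yR := rest_nbr xR xy; have y3 := rest_deg_le3 yR; apply: lerD.
    rewrite -[_ *+ 2]mulr_natl ler_wpM2l //; apply: weight_le_deg; lia.
  rewrite /far_count natr_sum mulr_suml; apply: ler_sum => z; rewrite in_setD1 => /andP[_ yz].
  have z3 := rest_deg_le3 (rest_nbr yR yz).
  have : weight y z <= (#|H|%:R - 6%:R)^-1 by apply: weight_le_deg; lia.
  case: (z \in nbr x); rewrite ?subn0 ?subn1 /=; lra.
rewrite loadE nx big_setU1 ?inE //= big_set1 -nx.
apply: le_trans (lerD (bound y1 _) (bound y2 _)) _; rewrite ?nx ?set21 ?set22 //.
by rewrite natrD; lra.
Qed.

Lemma rest_deg3 x : x \in rest -> deg x = 3%N.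
Proof.
move=> xR; have ge2 := rest_deg xR; have le3 := rest_deg_le3 xR.
have [x2|x2] := eqVneq (deg x) 2%N; last by lia.
have /cards2P[y1 [y2 [y12 nx]]] : #|nbr x| == 2%N by apply/eqP.
have xy1 : y1 \in nbr x by rewrite nx set21.
have xy2 : y2 \in nbr x by rewrite nx set22.
have y1R := rest_nbr xR xy1; have y2R := rest_nbr xR xy2.
have d1 := rest_deg_le3 y1R; have d2 := rest_deg_le3 y2R.
have f1 := far_countE xy1; have f2 := far_countE xy2.
(* A total of at most 6 would bound the load by [4 / (n - 5) + 6 / (n - 6)], less than
   [10 / (n - 6)]. *)
have ge7 : (7 <= far_count x y1 + far_count x y2)%N.
  rewrite leqNgt; apply/negP => lt7.
  have n6 : (6 < #|H|)%N := order_gt6.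
  have N7 : (7 : rat) <= #|H|%:R by rewrite (ler_nat _ 7).
  have := load_le_far_count xR nx y12; rewrite (loadP x).1; apply/negP; rewrite -ltNge.
  have ->: 10 / (#|H|%:R - 6) = 4 / (#|H|%:R - 6) + 6 / (#|H|%:R - 6) :> rat by lra.
  apply: ltr_leD.
    by rewrite ltr_pM2l // ltf_pV2 ?posrE; lra.
  by rewrite ler_wpM2r ?(ler_nat _ _ 6) // invr_ge0; lra.
(* If adjacent, [y1] and [y2] would each share a neighbour with [x], so each count would be at most
   3. *)
have nadj : y2 \notin nbr y1.
  apply/negP => y12n.
  have : (0 < #|nbr x :&: nbr y1|)%N by apply/card_gt0P; exists y2; rewrite inE xy2.
  have : (0 < #|nbr x :&: nbr y2|)%N.
    by apply/card_gt0P; exists y1; rewrite inE xy1 -nbr_sym.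
  lia.
have cap y : y \in nbr x -> nbr x :&: nbr y = set0.
  move=> xy; apply/setP => z; rewrite in_setI in_set0; apply/negP => /andP[].
  move: xy; rewrite nx !inE => /orP[] /eqP -> /orP[] /eqP ->; rewrite ?adj_irrefl //.
    by rewrite -in_nbr (negbTE nadj).
  by rewrite adj_sym -in_nbr (negbTE nadj).
(* Both counts are now even and at most 4, so a sum of at least 7 makes both equal to 4. *)
move: f1 f2; rewrite !cap // !cards0 => f1 f2.
have y1_3 : deg y1 = 3%N by lia.
have y2_3 : deg y2 = 3%N by lia.
have deg_nbr y : y \in nbr x -> deg y = 3%N.
  by rewrite nx !inE => /orP[] /eqP ->.
have n17 : (17 <= #|H|)%N.
  apply: (order_ge17 xR xy1); first by rewrite /edge_nbr cardsU cap // cards0 -!/(deg _); lia.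
  have := @sum_rest_deg_ge (nbr x); rewrite nx big_setU1 ?inE //= big_set1 y1_3 y2_3.
  by apply; rewrite subUset !sub1set y1R.
have := load_lt x n17; rewrite ltNge => /negP[].
rewrite loadE nx big_setU1 ?inE //= big_set1 -nx.
(* The edge [yx] and the two further edges at [y] all have multiplicity 2, since there are no
   triangles at [x]. *)
have term y : y \in nbr x -> 6 / (#|H|%:R - 4) <= weight y x *+ 2 +
    \sum_(z in nbr y :\ x) (weight y z *+ 2 - (z \in nbr x)%:R * weight y z).
  move=> xy; have y3 := deg_nbr y xy.
  have yx : x \in nbr y by rewrite -nbr_sym.
  rewrite (_ : 6 / _ = (#|H|%:R - 4)^-1 *+ 2 + (#|H|%:R - 4)^-1 *+ 2 *+ 2); last by lra.
  rewrite lerD // ?lerMn2r ?weight_bound ?y3 ?orbT //.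
  have card2 : #|nbr y :\ x| = 2%N.
    by move: y3; rewrite /deg (cardsD1 x) yx => -[].
  rewrite -[in X in _ *+ X <= _]card2 -sumr_const; apply: ler_sum => z.
  rewrite in_setD1 => /andP[_ yz].
  have /setP/(_ z) := cap y xy; rewrite in_setI yz andbT in_set0 => ->.
  by rewrite mul0r subr0 lerMn2r weight_bound ?y3 ?orbT.
by apply: le_trans (lerD (term _ xy1) (term _ xy2)); lra.
Qed.

Lemma rest_eq0 : rest = set0.
Proof.
apply/eqP; rewrite -subset0; apply/subsetP => x xR; exfalso.
have /card_gt0P[y xy] := deg_gt0 x.
(* With all degrees 3 in [rest], the slack gives [#|rest| < 2k]; as [#|rest| >= 4], there are at
   least 3 centres. *)
have n17 : (17 <= #|H|)%N.
  have [n] := rest_count; rewrite (eq_bigr (fun=> 3%N)) => [|z]; last exact: rest_deg3.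
  rewrite sum_nat_const; have := subset_leq_card (edge_nbr_rest xR xy).
  have := card_edge_nbr_ge xy; rewrite rest_deg3 //; lia.
have := load_lt x n17; rewrite ltNge => /negP[].
have -> : 12 / (#|H|%:R - 4) = (deg x)%:R * ((#|H|%:R - 4)^-1 * 2 + 2%:R * (#|H|%:R - 4)^-1) :> rat.
  by rewrite rest_deg3 //; lra.
have N17 : (17 : rat) <= #|H|%:R by rewrite (ler_nat _ 17).
apply: load_ge_deg; first by rewrite invr_ge0; lra.
  move=> z xz; have zR := rest_nbr xR xz; rewrite rest_deg3 //; split=> //.
  by rewrite weightC; apply: weight_bound; rewrite ?rest_deg3.
move=> z u xz zu; have zR := rest_nbr xR xz.
by apply: weight_bound; rewrite ?rest_deg3.
Qed.

Lemma centre_or_nbr x : star_centre x \/ exists2 y, y \in nbr x & star_centre y.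
Proof.
have [|xc] := boolP (star_centre x); first by left.
have [/eqP x1|x1] := boolP (deg x == 1%N); last first.
  by have := in_set0 x; rewrite -rest_eq0 inE xc x1.
right; have /card_gt0P[y xy] := deg_gt0 x.
by exists y => //; apply: leaf_nbr_centre xy.
Qed.

End EqualLoads.
End Neighbourhoods.

(** * Transfer of [star_centre] along isomorphisms and components *)

Section Isomorphisms.

Lemma isomorphic_sym (G H : sgraph) : isomorphic G H -> isomorphic H G.
Proof.
case=> f [g fK gK] fM; exists g; first by exists f.
by move=> x y; rewrite -fM !gK.
Qed.

Lemma deg_iso (G H : sgraph) (f : G -> H) x :
  bijective f -> {mono f : x y / adj x y} -> deg (f x) = deg x.
Proof.
move=> [g fK gK] fM; rewrite /deg -(card_imset _ (can_inj fK)); apply: eq_card => y.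
apply/idP/imsetP => [xy|[z xz ->]]; last by rewrite in_nbr fM -in_nbr.
by exists (g y); rewrite ?gK // in_nbr -fM gK -in_nbr.
Qed.

Lemma star_centre_iso (G H : sgraph) (f : G -> H) x :
  bijective f -> {mono f : x y / adj x y} -> star_centre x -> star_centre (f x).
Proof.
move=> fB fM /andP[x5 /forall_inP leaves]; apply/andP; split; first by rewrite deg_iso.
have [g fK gK] := fB; apply/forall_inP => y; rewrite -{}[y]gK in_nbr fM -in_nbr => /leaves.
by rewrite (deg_iso _ fB fM).
Qed.

Lemma in_nbr_component (H : sgraph) (x : H) (y z : component x) :
  (z \in nbr y) = (val z \in nbr (val y)).
Proof. exact: etrans (in_nbr y z) (esym (in_nbr (val y) (val z))). Qed.

Lemma component_nbr (H : sgraph) (x : H) (y : component x) (z : H) :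
  z \in nbr (val y) -> exists u : component x, val u = z.
Proof.
move=> yz; suff zP : z \in [set z | connect (@adj H) x z] by exists (Sub z zP).
have := valP y; rewrite !inE => xy; apply: connect_trans xy (connect1 _).
by rewrite -in_nbr.
Qed.

Lemma deg_component (H : sgraph) (x : H) (y : component x) : deg y = deg (val y).
Proof.
rewrite /deg -(card_imset _ val_inj); apply: eq_card => z.
apply/imsetP/idP => [[u yu ->]|yz]; first by rewrite -in_nbr_component.
have [u uz] := component_nbr yz.
by exists u; rewrite // in_nbr_component uz.
Qed.

Lemma star_centre_component (H : sgraph) (x : H) (y : component x) :
  star_centre y -> star_centre (val y).
Proof.
move=> /andP[y5 /forall_inP leaves]; apply/andP; split; first by rewrite -deg_component.
apply/forall_inP => z yz; have [u uz] := component_nbr yz.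
by rewrite -uz -deg_component leaves // in_nbr_component uz.
Qed.

Lemma star_centre_star : star_centre (None : star 5).
Proof.
apply/andP; split.
  rewrite /deg (_ : nbr _ = [set~ (None : star 5)]) ?cardsC1 ?card_option ?card_ord //.
  by apply/setP=> x; rewrite !inE.
apply/forall_inP => -[i|]; last by rewrite nbr_irrefl.
move=> _; apply/cards1P; exists (None : star 5); apply/setP => x.
by rewrite !inE.
Qed.

Lemma component_star5 (H : sgraph) (x : H) :
  isomorphic (component x) (star 5) -> exists c : H, star_centre c.
Proof.
move=> /isomorphic_sym[g gB gM]; exists (val (g None)).
by apply: star_centre_component; apply: star_centre_iso star_centre_star.
Qed.

Lemma closed_star (H : sgraph) (c : H) : star_centre c ->
  forall x y, adj x y -> (x \in c |: nbr c) = (y \in c |: nbr c).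
Proof.
move=> /andP[_ /forall_inP leaves].
suff sub x y : adj x y -> x \in c |: nbr c -> y \in c |: nbr c.
  by move=> x y xy; apply/idP/idP; apply: sub => //; rewrite adj_sym.
move=> xy /setU1P[xc|cx]; first by rewrite -xc !inE xy orbT.
have /eqP x1 := leaves x cx; have xc : c \in nbr x by rewrite -nbr_sym.
by have := nbr_leaf x1 xc => /setP/(_ y); rewrite in_nbr xy !inE => /esym ->.
Qed.

Lemma star_component (H : sgraph) (c x : H) : star_centre c -> x \in c |: nbr c ->
  isomorphic (component x) (star 5).
Proof.
move=> cc xc; apply: isomorphic_sym.
have [/eqP c5 /forall_inP leaves] := andP cc.
have closedS := closed_star cc.
have toc z : z \in c |: nbr c -> connect (@adj H) c z.
  by case/setU1P=> [->|]; rewrite ?connect0 // in_nbr; apply: connect1.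
have symc := sym_connect_sym (@adj_sym H).
have inC z : z \in c |: nbr c -> z \in [set z | connect (@adj H) x z].
  by move=> zc; rewrite inE; apply: connect_trans (toc z zc); rewrite symc toc.
have Cin (z : component x) : val z \in c |: nbr c.
  have := valP z; rewrite inE => xz.
  by rewrite -(@closed_connect _ (@adj H) (mem (c |: nbr c)) _ _ _ xz).
pose h (o : star 5) : H := if o is Some i then enum_val (cast_ord (esym c5) i) else c.
have hS o : h o \in c |: nbr c.
  by case: o => [i|]; rewrite /h ?setU11 // setU1r // enum_valP.
have hnbr i : h (Some i) \in nbr c by apply: enum_valP.
have hinj : injective h.
  move=> [i|] [j|] //=.
  - by move=> /enum_val_inj/cast_ord_inj ->.
  - by move=> e; have := hnbr i; rewrite /= e nbr_irrefl.
  - by move=> e; have := hnbr j; rewrite /= -e nbr_irrefl.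
pose g (o : star 5) : component x := Sub (h o) (inC _ (hS o)).
exists g; last first.
  move=> [i|] [j|]; rewrite /= /induced_adj !SubK /star_adj /=.
  - apply/negbTE/negP => ij; have /eqP i1 := leaves _ (hnbr i).
    have ci : c \in nbr (h (Some i)) by rewrite -nbr_sym hnbr.
    have := nbr_leaf i1 ci => /setP/(_ (h (Some j))).
    rewrite in_nbr ij inE => /esym /eqP e; have := hnbr j.
    by rewrite e nbr_irrefl.
  - by have := hnbr i; rewrite in_nbr adj_sym.
  - by have := hnbr j; rewrite in_nbr.
  - by rewrite adj_irrefl.
have ginj : injective g by move=> o o' /(congr1 val); rewrite !SubK; apply: hinj.
(* Injectivity suffices, as the component lies inside the 6 vertices of [c |: nbr c]. *)
apply: inj_card_bij => //.
rewrite card_option card_ord -(card_imset _ val_inj) -[X in (_ <= X)%N](_ : #|c |: nbr c| = _).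
  apply: subset_leq_card; apply/subsetP => _ /imsetP[z _ ->]; exact: Cin.
by rewrite cardsU1 nbr_irrefl -/(deg c) c5.
Qed.

End Isomorphisms.

(** * Betweenness in [G] expressed by weights in its complement *)

Section ComplementBetweenness.
Variable G : sgraph.
Implicit Types v w x z : G.
Local Notation H := (complement G).

Definition common v w : {set G} := [set z | adj v z & adj z w].

Lemma dist_adj v w : adj v w -> dist v w = 1%N.
Proof.
move=> vw; have nvw : v != w by apply: contraTneq vw => ->; rewrite adj_irrefl.
have : (1 < #|G|)%N.
  by apply/card_gt1P; exists v, w.
rewrite /dist; case: #|G| => [|[|n]] //= _.
case: existsP => [[p]|_].
  by rewrite tuple0 /path_between /= (negbTE nvw).
case: existsP => // -[]; exists [tuple w].
by rewrite /path_between /= vw inE nvw eqxx.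
Qed.

Lemma path2E v w z u : v != w ->
  path_between v w [:: z; u] = (u == w) && (z \in common v w).
Proof.
rewrite /path_between /= !inE !andbT => vw.
case: (u =P w) => [->|]; last by rewrite !andbF.
rewrite negb_or vw !andbT; case vz: (adj v z) => //=; case zw: (adj z w) => //=.
by apply/andP; split; [apply: contraTneq vz|apply: contraTneq zw] => ->; rewrite adj_irrefl.
Qed.

Lemma dist_nadj v w : v != w -> ~~ adj v w -> common v w != set0 -> dist v w = 2%N.
Proof.
move=> vw nvw /set0Pn[z zc].
have : (1 < #|G|)%N by apply/card_gt1P; exists v, w.
rewrite /dist; case: #|G| => [|[|n]] //= _.
case: existsP => [[p]|_].
  by rewrite tuple0 /path_between /= (negbTE vw).
case: existsP => [[p]|_].
  case/tupleP: p => u p; rewrite tuple0 /path_between /= andbT.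
  by case/and3P=> vu _ /eqP uw; rewrite -uw vu in nvw.
(* If [#|G|] is 2, the search fails and its default value is 2 anyway. *)
case: n => //= n; case: existsP => // -[]; exists [tuple z; w].
by rewrite path2E // eqxx zc.
Qed.

(** A path of length 2 is determined by its middle vertex. The predicate [Q] lets one count serve
    both [sigma] and [sigma_through]. *)
Lemma card_paths2 v w (Q : pred (seq G)) : v != w ->
  #|[set p : 2.-tuple G | path_between v w p & Q p]| =
  #|[set z in common v w | Q [:: z; w]]|.
Proof.
move=> vw; pose f z := [tuple z; w].
have finj : injective f by move=> z z' /(congr1 val) [].
rewrite -(card_imset _ finj); apply: eq_card => p.
case/tupleP: p => z p; case/tupleP: p => u p; rewrite tuple0 {p}.
rewrite inE [tval _]/= path2E //; apply/idP/imsetP => [|[z']].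
  case/andP=> /andP[/eqP -> zc] Qz; exists z; last exact: val_inj.
  by rewrite !inE in zc *; rewrite zc.
rewrite inE => /andP[zc Qz] /(congr1 val) [-> ->].
by rewrite eqxx zc.
Qed.

Lemma sigma_through_adj v w x : adj v w -> sigma_through v w x = 0%N.
Proof.
move=> vw; rewrite /sigma_through /shortest_paths dist_adj //.
apply/eqP; rewrite cards_eq0; apply/eqP/setP => p; rewrite !inE; apply/negbTE/negP.
case/tupleP: p => u p; rewrite tuple0 /path_between /= !inE.
by case/andP=> /and3P[_ _ /eqP ->] /andP[/orP[]/eqP->] /andP[]; rewrite eqxx.
Qed.

Lemma sigma_ratio_nadj v w x : v != w -> ~~ adj v w -> common v w != set0 ->
  (sigma_through v w x)%:R / (sigma v w)%:R = (x \in common v w)%:R / #|common v w|%:R :> rat.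
Proof.
move=> vw nvw c0; rewrite /sigma_through /sigma /shortest_paths (dist_nadj vw nvw c0).
congr (_%:R / _%:R).
  transitivity #|[set p : 2.-tuple G | path_between v w p
      & [&& x \in v :: p, x != v & x != w]]|.
    by apply: eq_card => p; rewrite !inE.
  rewrite (card_paths2 (fun p => [&& x \in v :: p, x != v & x != w]) vw).
  have [xc|xc] := boolP (x \in common v w).
    apply/eqP/cards1P; exists x; apply/setP => z; rewrite !inE.
    have xv : x != v by apply: contraTneq xc => ->; rewrite !inE adj_irrefl.
    have xw : x != w by apply: contraTneq xc => ->; rewrite !inE adj_irrefl andbF.
    rewrite (negbTE xv) (negbTE xw) /= orbF andbT (eq_sym x).
    by case: eqP => [->|]; rewrite ?andbF // andbT; rewrite inE in xc.
  apply/eqP; rewrite cards_eq0; apply/eqP/setP => z; rewrite inE [RHS]inE.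
  apply/negbTE/negP => /andP[zc]; rewrite !inE => /and3P[/or3P[]/eqP e xv xw].
  - by rewrite e eqxx in xv.
  - by rewrite e zc in xc.
  - by rewrite e eqxx in xw.
transitivity #|[set p : 2.-tuple G | path_between v w p & true]|.
  by apply: eq_card => p; rewrite !inE andbT.
rewrite (card_paths2 xpredT) //; apply: eq_card => z.
by rewrite inE andbT.
Qed.

(** The ends need no separate exclusion: being adjacent in [H], they lie in each other's
    neighbourhood. *)
Lemma commonE (v w : H) : adj v w -> common v w = ~: edge_nbr v w.
Proof.
move=> /= vw; apply/setP => z; rewrite !inE /= /compl_adj.
have [<-|vz] := eqVneq v z.
  by move: vw; rewrite /compl_adj adj_irrefl eq_sym (@adj_sym G w) => ->.
have [<-|wz] := eqVneq w z; first by rewrite adj_irrefl andbF orbF (negbTE (_ : ~~ @adj G v w)) //; case/andP: vw.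
by rewrite /= -negb_and negbK (@adj_sym G z w).
Qed.

Hypothesis diam2 : forall v w : H, adj v w -> common v w != set0.

Lemma edge_nbr_lt_card (v w : H) : w \in nbr v -> (#|edge_nbr v w| < #|H|)%N.
Proof.
rewrite in_nbr => vw; have := diam2 vw; rewrite commonE // -card_gt0 => gt0.
by rewrite -[X in (_ < X)%N](cardsC (edge_nbr v w)) -[X in (X < _)%N]addn0 ltn_add2l.
Qed.

Lemma card_edge_nbrC (v w : H) : #|~: edge_nbr v w| = (#|H| - #|edge_nbr v w|)%N.
Proof. by rewrite cardsCs setCK. Qed.

Lemma sigma_ratioE (v w x : H) : v != w ->
  (@sigma_through G v w x)%:R / (@sigma G v w)%:R =
  ((w \in nbr v) && (x \notin edge_nbr v w))%:R * weight v w.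
Proof.
move=> vw; have [avw|avw] := boolP (@adj G v w).
  by rewrite sigma_through_adj // in_nbr /= /compl_adj avw andbF !mul0r.
have hvw : adj v w by rewrite /= /compl_adj vw.
rewrite sigma_ratio_nadj ?diam2 // in_nbr hvw commonE // in_setC; congr (_ * _).
rewrite /weight; congr (_%:R^-1).
exact: (card_edge_nbrC v w).
Qed.

Lemma betweennessE (x : H) : @betweenness G x * 2 =
  \sum_v \sum_(w in nbr v | x \notin edge_nbr v w) weight v w.
Proof.
pose r (v w : H) : rat := ((w \in nbr v) && (x \notin edge_nbr v w))%:R * weight v w.
have rC v w : r v w = r w v by rewrite /r nbr_sym /edge_nbr setUC weightC.
have -> : @betweenness G x = \sum_(v : H) \sum_(w : H | (enum_rank v < enum_rank w)%N) r v w.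
  apply: eq_bigr => v _; apply: eq_bigr => w lt; apply: sigma_ratioE.
  by apply: contraTneq lt => ->; rewrite ltnn.
rewrite mulr_natr mulr2n [in X in _ + X](exchange_big_dep xpredT) //= -big_split.
apply: eq_bigr => v _ /=.
rewrite [X in X + _]big_mkcond [X in _ + X]big_mkcond [RHS]big_mkcond -big_split.
apply: eq_bigr => w _ /=; rewrite (rC w v) /r.
have [e|ne] := eqVneq v w.
  by rewrite -e nbr_irrefl mul0r ltnn addr0.
have : (enum_rank v != enum_rank w :> nat) by rewrite (inj_eq val_inj) (inj_eq enum_rank_inj).
by case: ltngtP => //= _ _; case: (_ && _); rewrite ?mul1r ?mul0r ?addr0 ?add0r.
Qed.

(** Each edge of [H] gives its weight either to the load or to the betweenness of [x], so equal
    betweenness means equal load. *)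
Lemma load_betweenness (x : H) : load x =
  \sum_(v : H) \sum_(w in nbr v) weight v w - @betweenness G x * 2.
Proof.
rewrite betweennessE -sumrB; apply: eq_bigr => v _.
by rewrite [X in X - _](bigID (fun w => x \in edge_nbr v w)) /= addrK.
Qed.

(** Each ordered edge spreads a total of exactly 1 over the vertices outside its [edge_nbr]. *)
Lemma sum_betweenness : \sum_(x : H) @betweenness G x * 2 = (\sum_(v : H) deg v)%:R.
Proof.
rewrite (eq_bigr _ (fun x _ => betweennessE x)).
rewrite exchange_big natr_sum; apply: eq_bigr => v _ /=.
rewrite (exchange_big_dep (fun w : H => w \in nbr v)) /=; last by move=> ? ? _ /andP[].
rewrite /deg -sum1_card natr_sum; apply: eq_bigr => w vw.
rewrite vw /= sumr_const.
have lt := edge_nbr_lt_card vw.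
rewrite (_ : #|_| = #|~: edge_nbr v w|); last by apply: eq_card => x; rewrite in_setC.
by rewrite card_edge_nbrC /weight -[_ *+ _]mulr_natl divff // lt0r_neq0 // ltr0n subn_gt0.
Qed.

End ComplementBetweenness.

(** * Conclusion for low-betweenness BUGs *)

Lemma complement_nonadj (G : sgraph) (v w : complement G) : v != w -> ~~ adj v w -> @adj G v w.
Proof. by move=> vw; rewrite /= /compl_adj vw negbK. Qed.

Lemma star_centre_union (G : sgraph) (c : complement G) :
  low_betweenness_BUG G -> star_centre c -> union_of_equal_stars (complement G).
Proof.
move=> [[_ equal] low] cc.
suff stars x : exists2 d : complement G, star_centre d & x \in d |: nbr d.
  by exists 5%N => x; have [d dd xd] := stars x; apply: star_component xd.
have [sub|/subsetPn[u _ uc]] := boolP ([set: complement G] \subset c |: nbr c).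
  by exists c => //; apply: (subsetP sub).
have closedS := closed_star cc.
have far (y z : complement G) : y \in c |: nbr c -> z \notin c |: nbr c -> @adj G y z.
  move=> yc zc; apply: complement_nonadj; first by apply: contraNneq zc => <-.
  by apply/negP => /closedS; rewrite yc (negbTE zc).
(* In [G] the star is completely joined to the remaining vertices: [u] serves pairs inside the star
   and [c] pairs outside it. *)
have diam2 (v w : complement G) : adj v w -> @common G v w != set0.
  move=> vw; apply/set0Pn; have [vc|vc] := boolP (v \in c |: nbr c).
    have wc : w \in c |: nbr c by rewrite -(closedS v).
    by exists u; rewrite inE (far v) // (@adj_sym G) far.
  have wc : w \notin c |: nbr c by rewrite -(closedS v).
  by exists c; rewrite inE (@adj_sym G) !far ?setU11.
have load_const (y z : complement G) : load y = load z.
  by rewrite !(load_betweenness diam2) (equal y z).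
have few_edges : (\sum_(v : complement G) deg v < 2 * #|complement G|)%N.
  rewrite -(ltr_nat rat) -(sum_betweenness diam2) natrM mulrC -mulr_suml ltr_pM2r //.
  rewrite -sum1_card natr_sum (bigD1 c) //= [ltRHS](bigD1 c) //=.
  by apply: ltr_leD; [exact: low|apply: ler_sum => y _; apply/ltW/low].
case: (centre_or_nbr (edge_nbr_lt_card diam2) load_const few_edges cc x) => [xc|[d xd dc]].
  by exists x; rewrite ?setU11.
by exists d; rewrite // setU1r // -nbr_sym.
Qed.

Theorem lemma28 :
  ~ exists H : sgraph,
      exotic_coBUG H /\ exists x : H, isomorphic (component x) (star 5).
Proof.
case=> H [[G [lowG exotic] [f fB fM]] [x /component_star5[c cc]]].
exact: exotic (star_centre_union lowG (star_centre_iso fB fM cc)).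
Qed.
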